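(* Let $R$ be an integral domain of characteristic zero, let $n$ be a positive integer, and let $M=(m_{i,j})\in \operatorname{Frac}(R)^{n\times n}$ be a frieze matrix. Writing $x_i=m_{i,i+1}$ for $1\le i\le n-1$, we have \[ \det(M) = -(-2)^{n-2}\, m_{1,n}\prod_{i=1}^{n-1} x_i . \]
   Context: A frieze matrix is a symmetric matrix $M=(m_{i,j})\in \operatorname{Frac}(R)^{n\times n}$ (with $\operatorname{Frac}(R)$ the field of fractions of $R$) such that $m_{i,j}=0$ if and only if $i=j$, and whose entries satisfy the generalized diamond rule \[ m_{i,j}m_{i+1,j+1}-m_{i+1,j}m_{i,j+1}=m_{i,i+1}m_{j,j+1} \] for all indices $1\le i$ and $j\ge i+1$ with $j+1\le n$. *)

(* Defs.v *)
From HB Require Import structures.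
From mathcomp Require Import all_boot all_order all_algebra.

Set Implicit Arguments.
Unset Strict Implicit.
Unset Printing Implicit Defensive.

Import GRing.Theory.
Local Open Scope ring_scope.

(* The size of a matrix is [n.+1] and indices are 0-based. For [i : 'I_n],    *)
(* [ord_lo i] and [ord_hi i] are the consecutive indices [i] and [i + 1]      *)
(* of ['I_n.+1].                                                              *)
Definition ord_lo (n : nat) (i : 'I_n) : 'I_n.+1 := widen_ord (leqnSn n) i.
Definition ord_hi (n : nat) (i : 'I_n) : 'I_n.+1 := lift ord0 i.

Definition generalized_diamond_rule (F : fieldType) (n : nat)
    (M : 'M[F]_n.+1) : Prop :=
  forall i j : 'I_n, (i < j)%N ->
    M (ord_lo i) (ord_lo j) * M (ord_hi i) (ord_hi j)
      - M (ord_hi i) (ord_lo j) * M (ord_lo i) (ord_hi j)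
    = M (ord_lo i) (ord_hi i) * M (ord_lo j) (ord_hi j).

Definition frieze_matrix (F : fieldType) (n : nat) (M : 'M[F]_n.+1) : Prop :=
  [/\ M^T = M,
      forall i j : 'I_n.+1, M i j = 0 <-> i = j
    & generalized_diamond_rule M].

(* Main.v *)
(* With u_j = m_{0,j} and v_j = m_{1,j} / m_{0,1} (and v_0 = -1), the diamond
   rule propagates row by row to m_{i,j} = u_i v_j - u_j v_i for all i <= j.
   By the Pluecker relations, the combination of rows
     u_{i+1} R_i - u_i R_{i+1} - x_i R_0            (0 < i < n)
   has entry - 2 x_i u_l in the columns l <= i and 0 in the others; after the
   exchange of the first and the last row the matrix becomes triangular. *)
Require Import Defs.
From HB Require Import structures.
From mathcomp Require Import all_boot all_order all_algebra all_fingroup.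
From mathcomp Require Import ring.

Set Implicit Arguments.
Unset Strict Implicit.
Unset Printing Implicit Defensive.

Import GRing.Theory.
Local Open Scope ring_scope.

Section Bracket.

Variables (F : fieldType) (f : nat -> nat -> F) (n : nat).
Hypothesis f_diag : forall i, f i i = 0.
Hypothesis f_neq0 : forall i j, (i < j <= n)%N -> f i j != 0.
Hypothesis f_diamond : forall i j, (i < j)%N -> (j < n)%N ->
  f i j * f i.+1 j.+1 - f i.+1 j * f i j.+1 = f i i.+1 * f j j.+1.

(** For a symmetric [f] the quotient at index 0 would be 1; the value [-1] instead makes the bracket
    of 0 and [j] return [f 0 j]. *)
Definition frieze_snd (j : nat) : F :=
  if j is 0 then -1 else f 1%N j / f 0%N 1%N.

(** For [j > 0] this is the diamond rule between rows 0 and 1, divided by [f 0 1]. *)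
Lemma frieze_bracket_succ j : (j < n)%N ->
  f j j.+1 = f 0%N j * frieze_snd j.+1 - f 0%N j.+1 * frieze_snd j.
Proof.
move=> ltjn; have f01 : f 0%N 1%N != 0 by apply: f_neq0; case: (n) ltjn.
case: j ltjn => [|j] ltjn /=; first by rewrite !f_diag; ring.
by apply: (mulfI f01); rewrite -f_diamond //; field.
Qed.

(** Induction on the row and, within a row, rightwards from the diagonal: as [f i j] is nonzero, the
    diamond rule determines [f i.+1 j.+1] from entries already known, and the brackets obey the same
    relation. *)
Lemma frieze_bracket i j : (i <= j)%N -> (j <= n)%N ->
  f i j = f 0%N i * frieze_snd j - f 0%N j * frieze_snd i.
Proof.
elim: i j => [|i IHi] j; first by rewrite f_diag /=; move=> *; ring.
elim: j => [|j IHj] //; rewrite ltnS leq_eqVlt => /predU1P[->|ltij] ltjn.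
  by rewrite f_diag; ring.
apply: (mulfI (f_neq0 (_ : i < j <= n)%N)); first by rewrite ltij ltnW.
have /eqP := f_diamond ltij ltjn; rewrite subr_eq => /eqP ->.
rewrite (IHj ltij (ltnW ltjn)) (frieze_bracket_succ ltjn).
rewrite (frieze_bracket_succ (ltn_trans ltij ltjn)).
rewrite (IHi j (ltnW ltij) (ltnW ltjn)) (IHi j.+1 (leqW (ltnW ltij)) ltjn).
ring.
Qed.

End Bracket.

Lemma sumr_delta (R : pzRingType) (I : finType) (k : I) (c : R) (h : I -> R) :
  \sum_j (c *+ (j == k)) * h j = c * h k.
Proof.
rewrite (bigD1 k) //= eqxx big1 ?addr0 // => j /negPf ->.
by rewrite mulr0n mul0r.
Qed.

Lemma det_row0 (R : comPzRingType) (m : nat) (A : 'M[R]_m.+1) :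
    (forall j, A ord0 (lift ord0 j) = 0) ->
  \det A = A ord0 ord0 * \det (\matrix_(i, j) A (lift ord0 i) (lift ord0 j)).
Proof.
move=> A0; rewrite (expand_det_row _ ord0) big_ord_recl big1 => [|j _].
  rewrite addr0 /cofactor addn0 expr0 mul1r; congr (_ * \det _).
  by apply/matrixP => i j; rewrite !mxE.
by rewrite A0 mul0r.
Qed.

Lemma det_col0 (R : comPzRingType) (m : nat) (A : 'M[R]_m.+1) :
    (forall i, A (lift ord0 i) ord0 = 0) ->
  \det A = A ord0 ord0 * \det (\matrix_(i, j) A (lift ord0 i) (lift ord0 j)).
Proof.
move=> A0; rewrite -det_tr det_row0 => [|j]; last by rewrite mxE.
rewrite mxE -det_tr; congr (_ * \det _).
by apply/matrixP => i j; rewrite !mxE.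
Qed.

Section BracketDet.

Variables (F : fieldType) (n : nat) (u v : nat -> F) (M : 'M[F]_n.+2).
Hypothesis u0 : u 0%N = 0.
Hypothesis v0 : v 0%N = -1.
Hypothesis u_neq0 : forall j, (0 < j <= n.+1)%N -> u j != 0.
Hypothesis symM : forall i j, M i j = M j i.
Hypothesis bracketM :
  forall i j : 'I_n.+2, (i <= j)%N -> M i j = u i * v j - u j * v i.

Let x i := u i * v i.+1 - u i.+1 * v i.
Let inner (i : nat) := (0 < i < n.+1)%N.

(** The first and last rows are those of the identity. In the last one [inord i.+1] is out of range
    and falls back to index 0, with coefficient 0. *)
Let T : 'M[F]_n.+2 := \matrix_(i, j)
  ((if inner i then u i.+1 else 1) *+ (j == i)
   - (if inner i then u i else 0) *+ (j == inord i.+1)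
   - (if inner i then x i else 0) *+ (j == ord0)).

Lemma bracket_row0 l : M ord0 l = u l.
Proof. by rewrite bracketM // u0 v0; ring. Qed.

(** In an inner row the first two terms add up to [x i * u l] for [l > i] and, as symmetry reverses
    the bracket, to its negative for [l <= i]. Subtracting [x i] times row 0 cancels the former and
    doubles the latter. *)
Lemma mul_elim_bracket i l : (T *m M) i l =
  if inner i then (- 2%:R * x i * u l) *+ (l <= i)%N else M i l.
Proof.
rewrite mxE; under eq_bigr do rewrite mxE !mulrBl.
rewrite !sumrB !sumr_delta; case: ifP => [/andP[_ lti]|_]; last by ring.
have vi : (inord i.+1 : 'I_n.+2) = i.+1 :> nat by rewrite inordK.
rewrite bracket_row0 /x; case: leqP => leli.
  rewrite (symM i) (symM (inord _)) !bracketM ?vi // 1?ltnW //=.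
  by rewrite mulr1n; ring.
by rewrite !bracketM ?vi // 1?ltnW //= mulr0n; ring.
Qed.

(** Expansion along row 0 removes column 0 with its entries [- x i]; what remains is upper
    triangular, with last diagonal entry 1. *)
Lemma det_elim : \det T = \prod_(i < n) u i.+2.
Proof.
rewrite det_row0 => [|j]; last first.
  by rewrite !mxE -!val_eqE /= !mul0rn mulr0n !subr0.
rewrite mxE -!val_eqE /= !mul0rn !subr0 mul1r.
rewrite -det_tr det_trig; last first.
  apply/is_trig_mxP => i j ltij; rewrite !mxE -!val_eqE /= !/bump /= !add1n.
  rewrite eqSS (ltn_eqF ltij) mulr0n; case: ifP => [/andP[_ ltjn]|_].
    by rewrite inordK // !eqSS (ltn_eqF (leqW ltij)) !mulr0n !subr0.
  by rewrite !mul0rn !subr0.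
rewrite big_ord_recr /= !mxE -!val_eqE /= !/bump /= !add1n /inner ltnn /=.
rewrite eqxx !mul0rn !subr0 mulr1.
apply: eq_bigr => i _; rewrite !mxE -!val_eqE /= !/bump /= !add1n /inner !ltnS ltn_ord /=.
by rewrite eqxx inordK ?ltnS // !eqSS (ltn_eqF (ltnSn i)) !mulr0n !subr0.
Qed.

Lemma det_mul_elim : \det (T *m M) =
  - (u n.+1 ^+ 2 * \prod_(i < n) (- 2%:R * x i.+1 * u i.+1)).
Proof.
pose s : 'S_n.+2 := tperm ord0 ord_max.
have {1}-> : T *m M = perm_mx s *m row_perm s (T *m M).
  by rewrite row_permE mulmxA -perm_mxM tperm2 perm_mx1 mul1mx.
rewrite det_mulmx det_perm odd_tperm mulN1r; congr (- _).
have rowS (i : 'I_n.+1) j : row_perm s (T *m M) (lift ord0 i) j =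
    if (i < n)%N then (- 2%:R * x i.+1 * u j) *+ (j <= i.+1)%N else u j.
  rewrite mxE; case: ltnP => lein.
    rewrite tpermD; first by rewrite mul_elim_bracket /inner /= ltnS lein.
      by rewrite -val_eqE.
    by rewrite -val_eqE /= /bump eq_sym /= add1n eqSS (ltn_eqF lein).
  have -> : lift ord0 i = ord_max.
    apply/val_inj/eqP; rewrite /= /bump add1n eqSS eqn_leq lein.
    by rewrite -ltnS ltn_ord.
  by rewrite tpermR mul_elim_bracket bracket_row0.
(* Below the top, column 0 consists of multiples of [u 0 = 0]. The top entry, from the old last row,
   is one factor [u n.+1]; the other ends the old row 0, now at the bottom. *)
rewrite det_col0 => [|i]; last by rewrite rowS u0 mulr0 mul0rn if_same.
rewrite mxE tpermL mul_elim_bracket /inner ltnn /= symM bracket_row0.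
rewrite det_trig; last first.
  apply/is_trig_mxP => i j ltij; rewrite mxE rowS.
  rewrite (leq_trans ltij (ltn_ord j : j <= n)%N).
  by rewrite /= /bump add1n leqNgt ltnS ltij mulr0n.
rewrite big_ord_recr /= mxE rowS ltnn expr2 -mulrA; congr (_ * _).
rewrite mulrC; congr (_ * _); apply: eq_bigr => i _.
by rewrite mxE rowS /= ltn_ord /bump /= leqnn.
Qed.

Lemma det_bracket :
  \det M = - (- 2%:R) ^+ n * u n.+1 * \prod_(i < n.+1) x i.
Proof.
have nzT : \prod_(i < n) u i.+2 != 0.
  by apply/prodf_neq0 => i _; apply: u_neq0; rewrite /= !ltnS.
apply: (mulfI nzT); rewrite -{1}det_elim -det_mulmx det_mul_elim.
have -> : \prod_(i < n) (- 2%:R * x i.+1 * u i.+1) =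
    (- 2%:R) ^+ n * \prod_(i < n) x i.+1 * \prod_(i < n) u i.+1.
  by rewrite !big_split /= prodr_const card_ord.
rewrite big_ord_recl /= /bump /= {2}/x u0 v0.
(* One of the two factors [u n.+1] completes the product, so that [\det T] cancels and leaves [u 1],
   which equals [x 0]. *)
have : u n.+1 * \prod_(i < n) u i.+1 = u 1%N * \prod_(i < n) u i.+2.
  have <- : \prod_(i < n.+1) u i.+1 = u 1%N * \prod_(i < n) u i.+2.
    by rewrite big_ord_recl.
  by rewrite big_ord_recr mulrC.
set p := \prod_(i < n) u i.+1; set q := \prod_(i < n) u i.+2 => pq.
set y := \prod_(i < n) x i.+1.
transitivity (- (- 2%:R) ^+ n * u n.+1 * y * (u n.+1 * p)); first by ring.
rewrite pq; ring.
Qed.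

End BracketDet.

Theorem theorem2p4 (R : idomainType) (charR0 : [pchar R] =i pred0)
    (n : nat) (M : 'M[{fraction R}]_n.+1) (friezeM : frieze_matrix M) :
  \det M = - ((- 2%:R) ^ (n.+1%:Z - 2%:Z))
           * M ord0 ord_max * \prod_(i < n) M (ord_lo i) (ord_hi i).
Proof.
case: n M friezeM => [|n] M [symM diagM diamondM].
  (* In size 1 the corner entry lies on the diagonal, so both sides vanish whatever the power with
     exponent -1 is. *)
  rewrite det_mx11 (_ : ord_max = ord0); last exact/val_inj.
  by rewrite (diagM ord0 ord0).2 // mulr0 mul0r.
(* Out-of-range indices are read as 0, hence the bounds in the facts below other than [f_diag]. *)
pose f i j := M (inord i) (inord j).
have f_diag i : f i i = 0 by apply/diagM.
have f_neq0 i j : (i < j <= n.+1)%N -> f i j != 0.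
  case/andP=> ltij lejn; apply/eqP => /diagM /(congr1 val) /=.
  by rewrite !inordK ?ltnS // 1?ltnW ?(leq_trans ltij) // => /eqP; rewrite ltn_eqF.
have loE (i : 'I_n.+1) : ord_lo i = inord i.
  by apply/val_inj; rewrite /= inordK // ltnW // ltnS.
have hiE (i : 'I_n.+1) : ord_hi i = inord i.+1.
  by apply/val_inj; rewrite /= inordK // ltnS.
have f_diamond i j : (i < j)%N -> (j < n.+1)%N ->
    f i j * f i.+1 j.+1 - f i.+1 j * f i j.+1 = f i i.+1 * f j j.+1.
  move=> ltij ltjn; have ltin := ltn_trans ltij ltjn.
  by have := diamondM (Ordinal ltin) (Ordinal ltjn) ltij; rewrite !loE !hiE.
have bracketM (i j : 'I_n.+2) : (i <= j)%N ->
    M i j = f 0%N i * frieze_snd f j - f 0%N j * frieze_snd f i.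
  move=> leij; rewrite -(frieze_bracket f_diag f_neq0 f_diamond leij) //.
    by rewrite /f !inord_val.
  by rewrite -ltnS.
rewrite (@det_bracket _ n (f 0%N) (frieze_snd f) M) //.
- have -> : (n.+2%:Z - 2%:Z) = n :> int by rewrite -addn2 PoszD addrK.
  rewrite -exprnP; congr (_ * _ * _).
    by rewrite bracketM // f_diag /=; ring.
  apply: eq_bigr => i _; rewrite loE hiE -/(f _ _).
  by rewrite (frieze_bracket_succ f_diag f_neq0 f_diamond).
- by move=> j /f_neq0.
- by move=> i j; rewrite -[in LHS]symM mxE.
Qed.
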